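(* Let $K$ be a finite field of odd characteristic, and $F = K(x, y)$, where $K(x)$ is a rational function field over $K$ and $y^2 = f(x)$ for some separable polynomial $f \in K[x] \setminus K$. Denote the integral closure of $K[x]$ in $F$ by $\mathcal{O}_F$. Then the following two statements are equivalent. (a) $u(\mathcal{O}_F) = \omega$. (b) The degree of $f$ is $2$ and the leading coefficient of $f$ is a square in $K$.
   Context: Unit sum number: let $R$ be a ring with identity and $k$ a positive integer. An element $r \in R$ is $k$-good if there are units $e_1, \ldots, e_k$ of $R$ with $r = e_1 + \cdots + e_k$. The ring $R$ is $k$-good if every element of $R$ is $k$-good. The unit sum number is $u(R) := \min\{k \mid R \text{ is } k\text{-good}\}$ if this minimum exists; if it does not exist but $R$ is additively generated by its units, then $u(R) := \omega$; if the units do not generate $R$ additively, then $u(R) := \infty$. A polynomial is separable if it has no repeated roots in an algebraic closure of $K$. *)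

(* Defs.v *)
From HB Require Import structures.
From mathcomp Require Import all_boot all_order all_algebra all_field.
From mathcomp Require Import boolp.

Set Implicit Arguments.
Unset Strict Implicit.
Unset Printing Implicit Defensive.

Import GRing.Theory.
Local Open Scope ring_scope.

Section UnitSumNumber.
Variable R : unitRingType.

Definition good_elt (k : nat) (r : R) : Prop :=
  exists2 e : 'I_k -> R, (forall i, e i \is a GRing.unit) & r = \sum_i e i.

Definition good_ring (k : nat) : Prop := forall r : R, good_elt k r.

(* The only additive subgroup of R containing all units is R itself. *)
Definition units_generate : Prop :=
  forall S : {pred R}, zmod_closed S ->
    (forall r, r \is a GRing.unit -> r \in S) -> forall r, r \in S.

(* USFin k is the finite value k, USOmega is omega, USInfty is infinity. *)
Inductive unit_sum_value := USFin of nat | USOmega | USInfty.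

Definition unit_sum_number : unit_sum_value :=
  match pselect (exists k, `[< (0 < k)%N /\ good_ring k >]) with
  | left exk => USFin (ex_minn exk)
  | right _ => if `[< units_generate >] then USOmega else USInfty
  end.

End UnitSumNumber.

Section IntegralClosure.
Variables (A : comNzRingType) (F : fieldType) (iota : {rmorphism A -> F}).

Definition integral_pred : {pred F} := fun u => `[< integralOver iota u >].

Fact integral_pred_subring : subring_closed integral_pred.
Proof.
split; first by apply/asboolP; apply: integral1.
- by move=> u v /asboolP Iu /asboolP Iv; apply/asboolP; apply: integral_sub.
- by move=> u v /asboolP Iu /asboolP Iv; apply/asboolP; apply: integral_mul.
Qed.

HB.instance Definition _ :=
  GRing.isSubringClosed.Build F integral_pred integral_pred_subring.

Record integral_closure : Type := IntegralClosure {
  ic_val : F;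
  _ : ic_val \in integral_pred
}.

HB.instance Definition _ := [isSub for ic_val].
HB.instance Definition _ := [Choice of integral_closure by <:].
HB.instance Definition _ :=
  [SubChoice_isSubComNzRing of integral_closure by <:].

(* Integrality and invertibility are made boolean classically, so that the
   integral closure is a unitRingType whose units are exactly its invertible
   elements. *)
Definition ic_unit : {pred integral_closure} :=
  fun a => `[< exists b, b * a = 1 >].

Definition ic_inv (a : integral_closure) : integral_closure :=
  match pselect (exists b, b * a = 1) with
  | left ex_b => sval (cid ex_b)
  | right _ => a
  end.

Fact ic_mulVr : {in ic_unit, left_inverse 1 ic_inv *%R}.
Proof.
by move=> a /asboolP ex_b; rewrite /ic_inv; case: pselect => // ?; case: cid.
Qed.

Fact ic_unitP (a b : integral_closure) : b * a = 1 -> ic_unit a.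
Proof. by move=> ba1; apply/asboolP; exists b. Qed.

Fact ic_inv_out : {in [predC ic_unit], ic_inv =1 id}.
Proof.
by move=> a /asboolP nex_b; rewrite /ic_inv; case: pselect => // /nex_b.
Qed.

HB.instance Definition _ := GRing.ComNzRing_hasMulInverse.Build
  integral_closure ic_mulVr ic_unitP ic_inv_out.

End IntegralClosure.

(* For F an extension of the rational function field K(x), realised as the
   fraction field of {poly K}, this is the embedding of K[x] into F. *)
Definition poly_emb (K : fieldType) (F : fieldExtType {fraction {poly K}}) :
    {rmorphism {poly K} -> F} :=
  GRing.RMorphism.clone {poly K} F (in_alg F \o @tofrac {poly K}) _.

(* Main.v *)
(* The integral closure is the free K[x]-module on 1 and y, and a + b y is a
   unit iff a^2 - f b^2 is a nonzero constant.  If two units have first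
   components a and a' of the same degree, then a and a' are proportional; hence
   a nonzero sum of first components of units has the degree of one of them.
   If the units generate, the polynomial x is such a sum, so some unit has
   deg a = 1, and comparing degrees and leading coefficients in a^2 - f b^2
   gives (b).  Conversely, if f = (c x + d)^2 - N, then c x + d + y and
   c x + d - y are units from which x and y are obtained, so the units generate.
   Moreover a |-> 2 a^2 - N turns first components of units into others of
   larger degree, so there are k + 1 of them with distinct degrees; their sum is
   not the first component of a sum of k units, because one of these degrees
   is not the degree of any of the k summands. *)
From HB Require Import structures.
Require Import Defs.
From mathcomp Require Import all_boot all_order all_algebra all_field.
From mathcomp Require Import boolp zify ring.

Set Implicit Arguments.
Unset Strict Implicit.
Unset Printing Implicit Defensive.

Import GRing.Theory.
Local Open Scope ring_scope.

(** * Sizes of polynomials and of sums of pairwise proportional polynomials *)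

Section Sizes.
Variable K : fieldType.

(* Restating these over a [fieldType] makes all sizes in the goals below use one
   and the same canonical structure path, as [lia] requires. *)
Lemma size_mulK (p q : {poly K}) :
  p != 0 -> q != 0 -> size (p * q) = (size p + size q).-1.
Proof. exact: size_mul. Qed.

Lemma size_polyCK (c : K) : (size c%:P <= 1)%N.
Proof. exact: size_polyC_leq1. Qed.

Lemma size_polyDK (p q : {poly K}) : (size (p + q)%R <= maxn (size p) (size q))%N.
Proof. exact: size_polyD. Qed.

Lemma size_polyNK (p : {poly K}) : size (- p) = size p.
Proof. exact: size_polyN. Qed.

Lemma size_sqr_poly (p : {poly K}) : size (p ^+ 2) = (size p).*2.-1.
Proof.
have [->|p0] := eqVneq p 0; first by rewrite expr0n size_poly0.
by rewrite expr2 size_mulK // addnn.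
Qed.

(* The summands of maximal degree are multiples of one of them, so either they
   give the degree of the sum or they cancel altogether and can be dropped. *)
Lemma size_sum_proportional (P : {poly K} -> Prop) (s : seq {poly K}) :
  (forall p q, P p -> P q -> size p = size q -> exists c, p = c *: q) ->
  (forall p, p \in s -> P p) ->
  \sum_(p <- s) p != 0 ->
  exists2 p, p \in s & size (\sum_(p <- s) p) = size p.
Proof.
move=> propP.
have [M] : exists M, forall p, p \in s -> (size p <= M)%N.
  elim: s => [|q s [M IH]]; first by exists 0.
  exists (maxn (size q) M) => p; rewrite inE leq_max.
  by case/predU1P => [->|/IH ->]; rewrite ?leqnn ?orbT.
(* Induction on the size bound; [s] stays general because, after a cancellation, it is replaced by a
   filtered sublist. *)
elim: M s => [|M IH] s leM Ps sum0.
  case/eqP: sum0; rewrite big_seq big1 // => p /leM.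
  by rewrite leqn0 size_poly_eq0 => /eqP.
rewrite (bigID (fun p : {poly K} => size p == M.+1)) /= in sum0 *.
set S2 := \sum_(p <- s | size p != M.+1) p in sum0 *.
have sS2 : (size S2 <= M)%N.
  rewrite /S2 big_seq_cond; apply: leq_trans (size_sum _ _ _) _.
  apply/bigmax_leqP_seq => p ps /andP[_ pM].
  by have := leM p ps; lia.
have [/hasP[q qs /eqP sq]|/hasPn none] := boolP (has (fun p : {poly K} => size p == M.+1) s).
  have [c Ec] : exists c, \sum_(p <- s | size p == M.+1) p = c *: q.
    rewrite big_seq_cond; elim/big_ind: _ => [|p1 p2 [c1 ->] [c2 ->]|p /andP[ps /eqP sp]].
    - by exists 0; rewrite scale0r.
    - by exists (c1 + c2); rewrite scalerDl.
    - by apply: propP; rewrite ?sp ?sq //; apply: Ps.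
  rewrite Ec in sum0 *.
  have [c0|c0] := eqVneq c 0; last first.
    exists q => //; rewrite size_polyDl size_scale // sq ltnS //.
  rewrite c0 scale0r add0r in sum0 *.
  have /IH : forall p, p \in [seq p : {poly K} <- s | size p != M.+1] -> (size p <= M)%N.
    by move=> p; rewrite mem_filter => /andP[+ /leM]; lia.
  rewrite big_filter -/S2 => -[].
  - by move=> p; rewrite mem_filter => /andP[_ /Ps].
  - by [].
  - by move=> p; rewrite mem_filter => /andP[_ ps ?]; exists p.
have Z : \sum_(p <- s | size p == M.+1) p = 0.
  by rewrite big_seq_cond big1 // => p /andP[/none/negP np /np].
rewrite Z add0r /S2 in sum0 *.
have E : \sum_(p <- s | size p != M.+1) p = \sum_(p <- s) p.
  rewrite big_seq_cond [RHS]big_seq; apply: eq_bigl => p.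
  by case: (boolP (p \in s)) => //= /none.
rewrite E in sum0 *.
have Ms : forall p, p \in s -> (size p <= M)%N.
  by move=> p ps; rewrite -ltnS ltn_neqAle leM // andbT; apply: none.
exact: IH Ms Ps sum0.
Qed.

End Sizes.

(** * The Pell equation over [K[x]] with nonzero constant right side *)

Section Pell.
Variables (K : fieldType) (f : {poly K}).
Hypothesis f_nonconst : (1 < size f)%N.

(** This says that the norm of [a + b y] is a unit of [K[x]]. *)
Definition pell_sol (a b : {poly K}) :=
  exists2 N : K, N != 0 & a ^+ 2 - f * b ^+ 2 = N%:P.

Definition pell_part (a : {poly K}) := exists b, pell_sol a b.

Let f_neq0 : f != 0. Proof. by rewrite -size_poly_gt0 ltnW. Qed.

(** If [b] were nonzero, [f * b ^+ 2] would be nonconstant like [f], whereas [a ^+ 2 - N] is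
    constant. *)
Lemma pell_const (a b : {poly K}) (N : K) :
  (size a <= 1)%N -> a ^+ 2 - f * b ^+ 2 = N%:P -> b = 0.
Proof.
move=> sa e; apply/eqP; apply: contraTT sa => b0; rewrite -ltnNge.
have e2 : f * b ^+ 2 = a ^+ 2 - N%:P by rewrite -e; ring.
have b20 : b ^+ 2 != 0 by rewrite expf_neq0.
have := congr1 (fun p : {poly K} => size p) e2.
rewrite size_mulK // size_sqr_poly => e3.
have b_gt0 : (0 < size b)%N by rewrite size_poly_gt0.
have := size_polyDK (a ^+ 2) (- N%:P); rewrite size_polyNK size_sqr_poly -e3.
have := size_polyCK N.
lia.
Qed.

(** As [f * b ^+ 2 = a ^+ 2 - N] has degree 2 and [f] is nonconstant, [b] must be constant;
    comparing leading coefficients then gives the square. *)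
Lemma pell_size2 (a : {poly K}) :
  pell_part a -> size a = 2 ->
  size f = 3 /\ exists c, lead_coef f = c ^+ 2.
Proof.
move=> [b [N N0 e]] sa.
have e2 : f * b ^+ 2 = a ^+ 2 - N%:P by rewrite -e; ring.
have s2 : size (a ^+ 2 - N%:P) = 3.
  rewrite size_polyDl ?size_polyNK size_sqr_poly sa //.
  by apply: leq_ltn_trans (size_polyCK N) _.
have b0 : b != 0.
  by apply: contra_eq_neq s2 => b0; rewrite -e2 b0 expr0n mulr0 size_poly0.
have sf : size f = 3 /\ size b = 1.
  have b_gt0 : (0 < size b)%N by rewrite size_poly_gt0.
  move: s2; rewrite -e2 size_mulK ?expf_neq0 // size_sqr_poly.
  lia.
split; first by case: sf.
exists (lead_coef a / lead_coef b).
have lb : lead_coef b != 0 by rewrite lead_coef_eq0.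
apply: (mulIf (expf_neq0 2 lb)).
rewrite -exprMn divfK // -!lead_coef_exp -lead_coefM e2 lead_coefDl //.
rewrite size_polyNK size_sqr_poly sa.
by apply: leq_ltn_trans (size_polyCK N) _.
Qed.

Lemma pell_part_neq0 a : pell_part a -> a != 0.
Proof.
move=> [b [N N0 e]]; apply: contraNneq N0 => a0; apply/eqP.
have b0 : b = 0 by apply: (@pell_const a b N) => //; rewrite a0 size_poly0.
by apply: (@polyC_inj K); rewrite -e a0 b0 !expr0n mulr0 subr0.
Qed.

Lemma pell_sol_conj a b : pell_sol a b -> pell_sol a (- b).
Proof. by move=> [N N0 e]; exists N => //; rewrite sqrrN. Qed.

Lemma pell_part_opp a : pell_part a -> pell_part (- a).
Proof. by move=> [b [N N0 e]]; exists b; exists N => //; rewrite sqrrN. Qed.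

(** The polynomial [a * a' - f * (b * b')] is the first component of [(a + b y) (a' - b' y)]. If it
    is constant, multiplicativity of the norm and [pell_const] make the second component vanish, so
    the two units differ by a constant factor. *)
Lemma pell_proportional_of_small a b a' b' :
  pell_sol a b -> pell_sol a' b' -> (size (a * a' - f * (b * b'))%R <= 1)%N ->
  exists c, a = c *: a'.
Proof.
move=> [N N0 e] [N' N'0 e'] s1.
pose A : {poly K} := a * a' - f * (b * b'); rewrite -/A in s1.
have eA : A ^+ 2 - f * (a * b' - a' * b) ^+ 2 = (N * N')%:P.
  by rewrite polyCM -e -e' /A; ring.
have B0 := pell_const s1 eA.
exists (A`_0 / N').
have AE : A = (A`_0)%:P by apply: size1_polyC.
have aN : a * N'%:P = A * a'.
  rewrite -e'.
  transitivity (a' * A - f * b' * (a * b' - a' * b)); first by rewrite /A; ring.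
  by rewrite B0; ring.
have N'P : N'%:P != 0 :> {poly K} by rewrite polyC_eq0.
apply: (mulIf N'P).
by rewrite aN {1}AE mul_polyC -scalerAl [a' * _]mulrC mul_polyC scalerA divfK.
Qed.

Hypothesis two_neq0 : (2%:R : K) != 0.

(* Of [a a' - f b b'] and [a a' + f b b'], whose sum is [2 a a'] and whose
   product has degree at most [deg (a a')], one has full degree, so the other
   one is constant. *)
Lemma pell_proportional a a' :
  pell_part a -> pell_part a' -> size a = size a' -> exists c, a = c *: a'.
Proof.
move=> Pa Pa' saa'.
have a0 := pell_part_neq0 Pa; have a'0 := pell_part_neq0 Pa'.
case: Pa Pa' => [b sab] [b' sab'].
have sabN' := pell_sol_conj sab'.
pose A1 : {poly K} := a * a' - f * (b * b').
pose A2 : {poly K} := a * a' - f * (b * - b').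
have [?|l1] := leqP (size A1) 1.
  exact: pell_proportional_of_small sab sab' _.
have [?|l2] := leqP (size A2) 1.
  exact: pell_proportional_of_small sab sabN' _.
exfalso.
have sgt : (0 < size a)%N by rewrite size_poly_gt0.
have sD : size (A1 + A2) = ((size a).*2.-1)%N.
  have -> : A1 + A2 = (2%:R : K) *: (a * a').
    by rewrite scaler_nat /A1 /A2; ring.
  by rewrite size_scale // size_mulK // -saa' addnn.
have := size_polyDK A1 A2; rewrite sD => l3.
case: sab sab' => [N N0 e] [N' N'0 e'].
(* Replacing [f * b ^+ 2] by [a ^+ 2 - N], and likewise for [b'], cancels the top term
   [a ^+ 2 * a' ^+ 2]. *)
have eM : A1 * A2 = N' *: a ^+ 2 + (N *: a' ^+ 2 + (- (N * N'))%:P).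
  by rewrite -!mul_polyC polyCN polyCM -e -e' /A1 /A2; ring.
have A10 : A1 != 0 by rewrite -size_poly_gt0 ltnW.
have A20 : A2 != 0 by rewrite -size_poly_gt0 ltnW.
have s2 : (0 < (size a).*2.-1)%N by lia.
have sM : (size (A1 * A2)%R <= (size a).*2.-1)%N.
  rewrite eM; apply: leq_trans (size_polyD _ _) _; rewrite geq_max.
  rewrite size_scale // size_sqr_poly leqnn /=.
  apply: leq_trans (size_polyD _ _) _; rewrite geq_max.
  rewrite size_scale // size_sqr_poly -saa' leqnn /=.
  exact: leq_trans (size_polyC_leq1 _) s2.
(* One factor has size at least [(size a).*2.-1] and the other at least 2, so the product is too
   large by one. *)
by move: sM; rewrite size_mulK //; lia.
Qed.

(** For nonconstant [a], the witness is the first component of [(a + b y) ^+ 2]. A nonzero constant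
    is its own witness, since [1.*2.-1 = 1]. *)
Lemma pell_part_double a :
  pell_part a -> exists2 a', pell_part a' & (size a).*2.-1 = size a'.
Proof.
move=> Pa; have a0 := pell_part_neq0 Pa.
have [sa|sa] := leqP (size a) 1.
  exists a => //.
  have : (0 < size a)%N by rewrite size_poly_gt0.
  lia.
case: Pa => [b [N N0 e]].
exists (a ^+ 2 + f * b ^+ 2).
  exists (2%:R * a * b); exists (N ^+ 2); first by rewrite expf_neq0.
  by rewrite polyC_exp -e; ring.
have -> : a ^+ 2 + f * b ^+ 2 = (2%:R : K) *: a ^+ 2 - N%:P.
  by rewrite scaler_nat -e; ring.
rewrite size_polyDl size_scale // size_sqr_poly // size_polyN.
by apply: leq_ltn_trans (size_polyCK N) _; lia.
Qed.

Lemma pell_parts_uniq_sizes a n :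
  pell_part a -> (1 < size a)%N ->
  exists s : seq {poly K}, [/\ size s = n,
    forall p, p \in s -> pell_part p &
    uniq (map (fun p : {poly K} => size p) s)].
Proof.
move=> Pa sa.
(* The induction also carries a nonconstant [q] larger than every entry, which is the next entry to
   be added. *)
suff [s [<- ? ? _]] : exists s : seq {poly K}, [/\ size s = n,
    forall p, p \in s -> pell_part p ,
    uniq (map (fun p : {poly K} => size p) s) &
    exists2 q, pell_part q & (1 < size q)%N /\
      forall p, p \in s -> (size p < size q)%N].
  by exists s.
elim: n => [|n [s [<- Ps us [q Pq [sq ltq]]]]].
  by exists [::]; split => //; exists a.
exists (q :: s); split => //=.
- by move=> p; rewrite inE => /predU1P[->//|/Ps].
- rewrite us andbT; apply/mapP => -[p /ltq + e]; by rewrite e ltnn.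
- have [q' Pq' e] := pell_part_double Pq; exists q' => //.
  have lq : (size q < size q')%N by rewrite -e; lia.
  split; first exact: ltn_trans sq lq.
  by move=> p; rewrite inE => /predU1P[->|/ltq/ltn_trans]; last exact.
Qed.

End Pell.

(** * Finite sums of units and the value [USOmega] *)

Section UnitSums.
Variable R : unitRingType.

Definition unit_sum (r : R) : Prop :=
  exists2 s : seq R, all (fun u => u \is a GRing.unit) s & r = \sum_(u <- s) u.

Lemma unit_sum_unit u : u \is a GRing.unit -> unit_sum u.
Proof. by move=> uu; exists [:: u]; rewrite /= ?uu // big_seq1. Qed.

Lemma unit_sum0 : unit_sum 0.
Proof. by exists [::] => //; rewrite big_nil. Qed.

Lemma unit_sumD r1 r2 : unit_sum r1 -> unit_sum r2 -> unit_sum (r1 + r2).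
Proof.
move=> [s1 u1 ->] [s2 u2 ->]; exists (s1 ++ s2); last by rewrite big_cat.
by rewrite all_cat u1.
Qed.

Lemma unit_sumN r : unit_sum r -> unit_sum (- r).
Proof.
move=> [s us ->]; exists (map -%R s); last by rewrite big_map sumrN.
by rewrite all_map (eq_all (a2 := fun u => u \is a GRing.unit)) // => u /=; rewrite unitrN.
Qed.

Lemma unit_sumM r1 r2 : unit_sum r1 -> unit_sum r2 -> unit_sum (r1 * r2).
Proof.
move=> [s1 u1 ->] [s2 u2 ->].
rewrite big_distrlr /= big_seq.
apply: (big_ind unit_sum unit_sum0 unit_sumD) => u /(allP u1) uu.
rewrite big_seq.
apply: (big_ind unit_sum unit_sum0 unit_sumD) => v /(allP u2) uv.
by apply: unit_sum_unit; rewrite unitrMl.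
Qed.

(** Opposites of units are units, so the finite sums of units already form an additive subgroup, and
    every additive subgroup containing the units contains them. *)
Lemma units_generateP : units_generate R <-> forall r, unit_sum r.
Proof.
split=> [gen r|sum S zS uS r].
  apply/asboolP; move: r; apply: (gen (fun r => `[< unit_sum r >])).
    split; first by apply/asboolP; apply: unit_sum0.
    move=> u v /asboolP su /asboolP sv; apply/asboolP.
    exact: unit_sumD su (unit_sumN sv).
  by move=> u uu; apply/asboolP; apply: unit_sum_unit.
have [S0 SB] := zS.
have [s us ->] := sum r; rewrite big_seq.
apply: (big_ind (fun r => r \in S)) => // [u v Su Sv|u /(allP us)]; last exact: uS.
by rewrite -[v]opprK SB // -[- v]add0r SB.
Qed.

Lemma unit_sum_number_omega :
  unit_sum_number R = USOmega <->
  units_generate R /\ forall k, (0 < k)%N -> ~ good_ring R k.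
Proof.
rewrite /unit_sum_number; case: pselect => [exk|nexk].
  split=> [//|[_ ngood]]; have [k kP] := exk.
  by have /asboolP[k0 /(ngood k k0)] := kP.
case: asboolP => [gen|ngen]; split=> //; last by case.
by move=> _; split=> // k k0 gk; case: nexk; exists k; apply/asboolP.
Qed.

End UnitSums.

(** * Sums of units in a ring that is free over [K[x]] on [1] and [y] *)

Section QuadraticRing.
Variables (K : fieldType) (f : {poly K}) (O : comUnitRingType).
Variables (iota : {rmorphism {poly K} -> O}) (y : O).
Hypotheses (f_nonconst : (1 < size f)%N) (two_neq0 : (2%:R : K) != 0).
Hypothesis y2 : y ^+ 2 = iota f.
Hypothesis free_y : forall a b, iota a + iota b * y = 0 -> a = 0 /\ b = 0.
Hypothesis gen_y : forall z, exists a b, z = iota a + iota b * y.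

Lemma pell_unit a b : pell_sol f a b -> iota a + iota b * y \is a GRing.unit.
Proof.
move=> [N N0 e]; apply/unitrPr.
(* The inverse is the conjugate divided by the norm. *)
exists (iota (N^-1)%:P * (iota a - iota b * y)).
have -> : (iota a + iota b * y) * (iota (N^-1)%:P * (iota a - iota b * y)) =
    iota ((N^-1)%:P * (a ^+ 2 - f * b ^+ 2)).
  by rewrite rmorphM rmorphB (rmorphM iota f) !rmorphXn -y2; ring.
rewrite e.
by rewrite -polyCM mulVf // !rmorph1.
Qed.

(** The norm is multiplicative, so the norm of a unit is a unit of [K[x]], that is, a nonzero
    constant. *)
Lemma unit_pell a b : iota a + iota b * y \is a GRing.unit -> pell_sol f a b.
Proof.
move=> /unitrPr[z]; have [a' [b' ->]] := gen_y z => e.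
have [e1 e2] : a * a' + f * (b * b') - 1 = 0 /\ a * b' + a' * b = 0.
  apply: free_y.
  rewrite rmorphB /= rmorph1 !rmorphD /= !rmorphM -y2 -e; ring.
have {}e1 : a * a' + f * (b * b') = 1 by apply/eqP; rewrite -subr_eq0 e1.
have eN : (a ^+ 2 - f * b ^+ 2) * (a' ^+ 2 - f * b' ^+ 2) = 1.
  transitivity ((a * a' + f * (b * b')) ^+ 2 - f * (a * b' + a' * b) ^+ 2).
    by ring.
  by rewrite e1 e2; ring.
have : a ^+ 2 - f * b ^+ 2 \is a GRing.unit.
  by apply/unitrPr; exists (a' ^+ 2 - f * b' ^+ 2).
rewrite poly_unitE => /andP[/eqP/eq_leq/size1_polyC eC].
by rewrite unitfE => N0; exists (a ^+ 2 - f * b ^+ 2)`_0.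
Qed.

(** Here [re] is the first coordinate in the basis [1], [y]. It comes from [choice]; [free_y] makes
    its value unique, whence additivity. *)
Lemma re_exists : exists re : O -> {poly K},
  [/\ {morph re : u v / u + v}, re 0 = 0, (forall a, re (iota a) = a) &
      forall u, u \is a GRing.unit -> pell_part f (re u)].
Proof.
have [re reP] := choice gen_y.
have reE z a b : z = iota a + iota b * y -> re z = a.
  move=> ez; have [b' ez'] := reP z.
  have [/eqP + _] : re z - a = 0 /\ b' - b = 0.
    by apply: free_y; rewrite !rmorphB /= mulrBl addrACA -opprD -ez -ez' subrr.
  by rewrite subr_eq0 => /eqP.
exists re; split.
- move=> u v; have [b eu] := reP u; have [b' ev] := reP v.
  by apply: (reE _ _ (b + b')); rewrite {1}eu {1}ev !rmorphD /=; ring.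
- by apply: (reE _ _ 0); rewrite !rmorph0 mul0r addr0.
- by move=> a; apply: (reE _ _ 0); rewrite rmorph0 mul0r addr0.
- move=> u; have [b eu] := reP u; rewrite {1}eu => /unit_pell; by exists b.
Qed.

Lemma re_sum_units :
  exists re : O -> {poly K}, forall s : seq O,
  all (fun u => u \is a GRing.unit) s -> forall a, iota a = \sum_(u <- s) u ->
  a = \sum_(p <- map re s) p /\ forall p, p \in map re s -> pell_part f p.
Proof.
have [re [reD re0 re_iota re_unit]] := re_exists; exists re => s us a ea.
split; last by move=> p /mapP[u /(allP us)/re_unit + ->].
by rewrite big_map -(big_morph re reD re0) -ea re_iota.
Qed.

Lemma generated_deg2 : units_generate O ->
  size f = 3 /\ exists c, lead_coef f = c ^+ 2.
Proof.
move=> /units_generateP/(_ (iota 'X))[s us e].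
have [re /(_ s us _ e)[eX Ps]] := re_sum_units.
have propP := @pell_proportional _ _ f_nonconst two_neq0.
have [|p ps] := size_sum_proportional propP Ps; first by rewrite -eX polyX_eq0.
by rewrite -eX size_polyX => /esym; apply: pell_size2 => //; apply: Ps.
Qed.

Lemma not_good_ring a k : pell_part f a -> (1 < size a)%N -> ~ good_ring O k.
Proof.
move=> Pa sa good.
have [s [ss Ps us]] := pell_parts_uniq_sizes f_nonconst two_neq0 k.+1 Pa sa.
have [e ue er] := good (iota (\sum_(p <- s) p)).
have ue' : all (fun u => u \is a GRing.unit) [seq e i | i <- enum 'I_k].
  by apply/allP => _ /mapP[i _ ->].
have [re /(_ _ ue' (\sum_(p <- s) p))[]] := re_sum_units.
  by rewrite er big_map big_enum.
set t := map re _ => et Pt.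
have st : size t = k by rewrite 2!size_map -cardE card_ord.
(* Pigeonhole: [s] has [k.+1] distinct sizes, while [t] has only [k] entries. *)
have [p ps np] : exists2 p : {poly K}, p \in s &
    size p \notin [seq size (q : {poly K}) | q <- t].
  apply: contrapT => all_in.
  have /uniq_leq_size : {subset [seq size (q : {poly K}) | q <- s] <=
      [seq size (q : {poly K}) | q <- t]}.
    move=> _ /mapP[p ps ->]; apply/negPn/negP => np; apply: all_in; by exists p.
  by move=> /(_ us); rewrite (size_map _ s) (size_map _ t) st ss ltnn.
(* Since [s] and [t] have the same sum, [p] is the sum of [w], so some entry of [w] has the size of
   [p]. The choice of [p] excludes the entries of [t], and distinctness of sizes in [s] excludes the
   others. *)
pose w := t ++ map -%R (rem p s).
have uniq_s : uniq s by apply: map_uniq us.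
have ew : p = \sum_(q <- w) q.
  rewrite big_cat /= -et [X in _ + X]big_map sumrN (perm_big _ (perm_to_rem ps)) big_cons.
  by rewrite addrK.
have Pw q : q \in w -> pell_part f q.
  rewrite mem_cat => /orP[/Pt //|/mapP[q' + ->]] => /mem_rem /Ps.
  exact: pell_part_opp.
have propP := @pell_proportional _ _ f_nonconst two_neq0.
have p0 : p != 0 := pell_part_neq0 f_nonconst (Ps _ ps).
have [|q qw] := size_sum_proportional propP Pw; first by rewrite -ew.
rewrite -ew => spq; move: qw; rewrite mem_cat => /orP[qt|].
  by move/negP: np; apply; rewrite spq; apply/mapP; exists q.
move=> /mapP[q' q's eq]; move: spq; rewrite eq size_polyN => spq.
move: q's; rewrite mem_rem_uniq // inE => /andP[/negP ne q's]; apply: ne.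
have := us; rewrite (perm_uniq (perm_map _ (perm_to_rem ps))) /= => /andP[/negP nin _].
case: eqP => // ne; case: nin; apply/mapP; exists q' => //.
by rewrite mem_rem_uniq // inE q's andbT; apply/eqP.
Qed.

(** Completing the square: [d] makes [(c x + d) ^+ 2] agree with [f] except in the constant term.
    The remaining constant is nonzero, as otherwise [f] would be a square, against separability. *)
Lemma square_lead_pell (c : K) :
  separable_poly f -> size f = 3 -> lead_coef f = c ^+ 2 ->
  c != 0 /\ exists d, pell_sol f (c *: 'X + d%:P) 1.
Proof.
move=> sepf sf lf.
have c0 : c != 0.
  apply: contra_eq_neq lf => ->; rewrite expr0n /= lead_coef_eq0.
  by rewrite -size_poly_eq0 sf.
split=> //; pose d := f`_1 / (2%:R * c); exists d.
set l := c *: 'X + d%:P.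
have eN : l ^+ 2 - f * 1 ^+ 2 = (d ^+ 2 - f`_0)%:P.
  apply/polyP => i; rewrite expr1n mulr1.
  have -> : l ^+ 2 = (c ^+ 2) *: 'X^2 + (2%:R * c * d) *: 'X + (d ^+ 2)%:P.
    by rewrite /l -!mul_polyC !polyCM polyC_natr; ring.
  have -> : 2%:R * c * d = f`_1 by rewrite /d mulrC divfK // mulf_neq0.
  have -> : c ^+ 2 = f`_2 by rewrite -lf /lead_coef sf.
  rewrite !coefE; case: i => [|[|[|i]]] /=; rewrite ?mulr0 ?mulr1 ?addr0 ?add0r ?subrr //.
  by rewrite nth_default ?oppr0 ?sf.
exists (d ^+ 2 - f`_0) => //; apply/eqP => N0.
have ef : f = l ^+ 2.
  by apply/esym/eqP; rewrite -subr_eq0 -[f in _ - f]mulr1 -[in X in _ - X](expr1n _ 2) eN N0.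
have sl : size l != 1.
  by rewrite /l size_polyDl size_scale // size_polyX // ltnS size_polyC_leq1.
have := separable_nosquare sepf (ltnSn 1) sl.
by rewrite -ef dvdpp.
Qed.

(** Sums of units are closed under sums, opposites and products and include the constants, so it
    suffices to reach ['X] and [y]. These come from the units [l + y] and [l - y] by adding,
    subtracting and halving. *)
Lemma deg2_generated (c : K) :
  separable_poly f -> size f = 3 -> lead_coef f = c ^+ 2 -> units_generate O.
Proof.
move=> sepf sf lf; have [c0 [d sol]] := square_lead_pell sepf sf lf.
set l := c *: 'X + d%:P in sol.
have scalar k : unit_sum (iota k%:P).
  have [->|k0] := eqVneq k 0; first by rewrite !rmorph0; apply: unit_sum0.
  apply/unit_sum_unit/unitrPr; exists (iota k^-1%:P).
  by rewrite -rmorphM -polyCM mulfV // !rmorph1.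
have su : unit_sum (iota l + y).
  by have /pell_unit := sol; rewrite rmorph1 mul1r => /unit_sum_unit.
have sv : unit_sum (iota l - y).
  have /pell_unit := pell_sol_conj sol.
  by rewrite rmorphN rmorph1 mulN1r => /unit_sum_unit.
have half (z : O) : z = iota (2%:R^-1)%:P * (z + z).
  rewrite -mulr2n -(mulr_natl z 2) -(rmorph_nat iota 2) mulrA -rmorphM.
  by rewrite -(polyC_natr K 2) -polyCM mulVf // !rmorph1 mul1r.
have sl : unit_sum (iota l).
  rewrite [iota l]half; apply: unit_sumM => //.
  have -> : iota l + iota l = (iota l + y) + (iota l - y) by ring.
  exact: unit_sumD.
have sy : unit_sum y.
  rewrite [y]half; apply: unit_sumM => //.
  have -> : y + y = (iota l + y) - (iota l - y) by ring.
  exact: unit_sumD (unit_sumN _).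
have sX : unit_sum (iota 'X).
  have -> : 'X = c^-1%:P * (l - d%:P).
    by rewrite /l addrK -mul_polyC mulrA -polyCM mulVf // mul1r.
  by rewrite rmorphM rmorphB; apply: unit_sumM (unit_sumD _ (unit_sumN _)).
have spoly a : unit_sum (iota a).
  elim/poly_ind: a => [|a k IH]; first by rewrite rmorph0; apply: unit_sum0.
  by rewrite rmorphD rmorphM; apply: unit_sumD (unit_sumM _ _) _.
apply/units_generateP => z; have [a [b ->]] := gen_y z.
exact: unit_sumD (spoly a) (unit_sumM _ _).
Qed.

Theorem quadratic_ring_omega : separable_poly f ->
  unit_sum_number O = USOmega <->
  size f = 3 /\ exists c, lead_coef f = c ^+ 2.
Proof.
move=> sepf; split.
  by move=> /unit_sum_number_omega[/generated_deg2].
move=> [sf [c lf]]; apply/unit_sum_number_omega; split.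
  exact: deg2_generated lf.
move=> k _; have [c0 [d sol]] := square_lead_pell sepf sf lf.
apply: (@not_good_ring (c *: 'X + d%:P)); first by exists 1.
by rewrite size_polyDl size_scale // size_polyX // ltnS size_polyC_leq1.
Qed.

End QuadraticRing.

(** * The embedding of the base ring into its integral closure *)

Section IntegralClosureEmbedding.
Variables (A : comNzRingType) (F : fieldType) (iota : {rmorphism A -> F}).

Fact ic_emb_subproof (a : A) : iota a \in integral_pred iota.
Proof. by apply/asboolP; apply: integral_id. Qed.

Definition ic_emb (a : A) : integral_closure iota :=
  IntegralClosure (ic_emb_subproof a).

Fact ic_emb_zmod_morphism : zmod_morphism ic_emb.
Proof. by move=> a b; apply: val_inj; rewrite /= !rmorphB. Qed.

Fact ic_emb_monoid_morphism : monoid_morphism ic_emb.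
Proof.
split=> [|a b]; apply: val_inj; first by rewrite /= !rmorph1.
by rewrite /= !rmorphM.
Qed.

HB.instance Definition _ := GRing.isZmodMorphism.Build A
  (integral_closure iota) ic_emb ic_emb_zmod_morphism.
HB.instance Definition _ := GRing.isMonoidMorphism.Build A
  (integral_closure iota) ic_emb ic_emb_monoid_morphism.

End IntegralClosureEmbedding.

(** * Integral fractions over [K[x]] and reduced representations of fractions *)

Section RationalRoot.
Variables (K L : fieldType) (phi : {rmorphism {poly K} -> L}).
Hypothesis phi_inj : injective phi.

(** Rational root theorem: clearing denominators in a monic equation of degree [m] gives
    [d %| n ^+ m], so by coprimality [d] is constant. *)
Lemma integral_fraction (x : L) (n d : {poly K}) :
  coprimep n d -> x * phi d = phi n -> integralOver phi x ->
  exists p, x = phi p.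
Proof.
move=> co_nd xd [P monP /rootP P0].
have Pgt0 : (0 < size P)%N by rewrite size_poly_gt0 monic_neq0.
pose m := (size P).-1.
have Pm : P`_m = 1 := monicP monP.
(* The exponent is [m.-1 - i] because one factor [d] has been taken out of [d ^+ (m - i)]. *)
have /phi_inj e : phi (n ^+ m + d * \sum_(i < m) P`_i * n ^+ i * d ^+ (m.-1 - i)) = phi 0.
  transitivity ((map_poly phi P).[x] * phi d ^+ m); last by rewrite P0 rmorph0 mul0r.
  have smap : size (map_poly phi P) = m.+1.
    by rewrite size_map_poly_id0 ?prednK // (monicP monP) rmorph1 oner_neq0.
  rewrite horner_coef smap big_ord_recr /= !coef_map /= Pm rmorph1 mul1r mulrDl.
  rewrite -exprMn xd addrC rmorphD rmorphXn rmorphM rmorph_sum mulr_sumr mulr_suml /=.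
  congr (_ + _); apply: eq_bigr => i _.
  have -> : phi d ^+ m = phi d ^+ i * (phi d * phi d ^+ (m.-1 - i)).
    by rewrite -exprS -exprD; congr (_ ^+ _); have := ltn_ord i; lia.
  by rewrite coef_map !rmorphM !rmorphXn -xd exprMn; ring.
have dn : d %| n ^+ m.
  rewrite -(dvdp_addl _ (dvdp_mulIl d (\sum_(i < m) P`_i * n ^+ i * d ^+ (m.-1 - i)))).
  by rewrite e dvdp0.
have {dn} d1 : size d == 1.
  have co : coprimep d (n ^+ m) by rewrite coprimep_expr // coprimep_sym.
  by rewrite -dvdp1 -(Gauss_dvdpr _ co) mulr1.
have [c c0 dc] := size_poly1P _ d1.
exists (c^-1 *: n).
have pd0 : phi d != 0.
  by rewrite -(rmorph0 phi) (inj_eq phi_inj) dc polyC_eq0.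
apply: (mulIf pd0); rewrite xd -rmorphM; congr (phi _).
by rewrite dc mulrC mul_polyC scalerA mulfV // scale1r.
Qed.

End RationalRoot.

Lemma fraction_repr (R : idomainType) (x : {fraction R}) :
  exists n d : R, d != 0 /\ x * tofrac d = tofrac n.
Proof.
elim/quotW: x => x; exists \n_x, \d_x; split; first exact: denom_ratioP.
rewrite -{1}(Ratio_numden x); unlock tofrac.
rewrite -[LHS]pi_mul; apply/eqmodP => /=.
rewrite /mulf !numden_Ratio ?oner_eq0 ?denom_ratioP // FracField.equivfE.
by rewrite !numden_Ratio ?mulf_neq0 ?oner_eq0 ?denom_ratioP // !mulr1 mulrC.
Qed.

Lemma fraction_coprime (K : fieldType) (x : {fraction {poly K}}) :
  exists n d : {poly K}, [/\ d != 0, coprimep n d & x * tofrac d = tofrac n].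
Proof.
have [n [d [d0 e]]] := fraction_repr x.
have g0 : gcdp n d != 0 by rewrite gcdp_eq0 negb_and d0 orbT.
exists (n %/ gcdp n d), (d %/ gcdp n d); split.
- by rewrite dvdp_div_eq0 ?dvdp_gcdr.
- by apply: coprimep_div_gcd; rewrite d0 orbT.
- have tg0 : tofrac (gcdp n d) != 0 by rewrite tofrac_eq0.
  apply: (mulIf tg0); rewrite -mulrA -!rmorphM /= !divpK ?dvdp_gcdl ?dvdp_gcdr //.
Qed.

(** * The integral closure is free on [1] and [y]; [E] and [L] stand for [K(x)] and [F] *)

Section QuadraticExtension.
Variables (K : fieldType) (f : {poly K}).
Hypotheses (f_sep : separable_poly f) (f_nonconst : (1 < size f)%N).
Hypothesis two_neq0 : (2%:R : K) != 0.
Variables (E L : fieldType) (tau : {rmorphism {poly K} -> E}).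
Variables (j : {rmorphism E -> L}) (phi : {rmorphism {poly K} -> L}) (y : L).
Hypothesis phiE : forall p, phi p = j (tau p).
Hypothesis tau_frac : forall t : E, exists n d : {poly K},
  [/\ d != 0, coprimep n d & t * tau d = tau n].
Hypothesis tau_inj : injective tau.
Hypothesis y2 : y ^+ 2 = phi f.
Hypothesis y_gen : forall z, exists p : {poly E}, z = (map_poly j p).[y].

Let tau_eq0 p : (tau p == 0) = (p == 0).
Proof. by rewrite -(rmorph0 tau) (inj_eq tau_inj). Qed.

Let phi_inj : injective phi.
Proof. by move=> p q; rewrite !phiE => /fmorph_inj/tau_inj. Qed.

Lemma integral_base (t : E) :
  integralOver phi (j t) -> exists p, t = tau p.
Proof.
have [n [d [d0 co e]]] := tau_frac t.
have e' : j t * phi d = phi n by rewrite !phiE -rmorphM e.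
move=> /(integral_fraction phi_inj co e')[p ep]; exists p.
by move: ep; rewrite phiE => /fmorph_inj.
Qed.

Lemma square_dvd_const (d : {poly K}) : d ^+ 2 %| f -> size d = 1.
Proof.
move=> df; apply/eqP; apply: contraTT df => sd.
by rewrite (separable_nosquare f_sep).
Qed.

(** Otherwise [y = - a / b] would be an integral element of [E], hence a polynomial [p] with
    [f = p ^+ 2]; separability would make [p], and so [f], constant. *)
Lemma base_free (a b : E) :
  j a + j b * y = 0 -> a = 0 /\ b = 0.
Proof.
move=> e; have [b0|b0] := eqVneq b 0.
  move: e; rewrite b0 rmorph0 mul0r addr0 => /eqP.
  by rewrite fmorph_eq0 => /eqP.
exfalso.
have b0' : j b != 0 by rewrite fmorph_eq0.
pose t := - a / b.
have ty : j t = y.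
  apply: (mulfI b0'); rewrite -rmorphM /t mulrC divfK // rmorphN.
  by apply/eqP; rewrite eq_sym -subr_eq0 opprK addrC e.
have [p tp] : exists p, t = tau p.
  apply: integral_base; rewrite ty.
  exists ('X^2 - f%:P); first by rewrite monicXnsubC.
  by rewrite rmorphB /= map_polyXn map_polyC /root !hornerE y2 subrr.
have fp : f = p ^+ 2.
  by apply: phi_inj; rewrite -y2 -ty tp rmorphXn phiE.
have sp : size p = 1 by apply: square_dvd_const; rewrite {1}fp dvdpp.
by move: f_nonconst; rewrite fp size_sqr_poly sp.
Qed.

Lemma base_gen (z : L) : exists a b : E, z = j a + j b * y.
Proof.
have [p ->] := y_gen z.
elim/poly_ind: p => [|p c [a [b IH]]].
  by exists 0, 0; rewrite rmorph0 horner0 !rmorph0 mul0r addr0.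
(* These are the coordinates of [(a + b y) y + c] after replacing [y ^+ 2] by [f]. *)
exists (b * tau f + c), a.
rewrite rmorphD rmorphM /= map_polyX map_polyC !hornerE IH.
rewrite rmorphD rmorphM -phiE -y2; ring.
Qed.

(* Evaluation commutes with the conjugation [a + b y -> a - b y]. *)
Lemma horner_conj (P : {poly {poly K}}) (a b : E) : exists u v : E,
  (map_poly phi P).[j a + j b * y] = j u + j v * y /\
  (map_poly phi P).[j a - j b * y] = j u - j v * y.
Proof.
elim/poly_ind: P => [|P c [u [v [IH1 IH2]]]].
  by exists 0, 0; rewrite rmorph0 !horner0 !rmorph0 mul0r addr0 subr0.
exists (u * a + v * b * tau f + tau c), (u * b + v * a).
rewrite rmorphD rmorphM /= map_polyX map_polyC !hornerE IH1 IH2.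
rewrite !rmorphD !rmorphM -!phiE -y2 /=; split; ring.
Qed.

(** The same monic polynomial serves: its value at the conjugate is the conjugate of [0]. *)
Lemma integral_conj (a b : E) :
  integralOver phi (j a + j b * y) ->
  integralOver phi (j a - j b * y).
Proof.
move=> [P monP /rootP P0]; exists P => //; apply/rootP.
have [u [v [e1 ->]]] := horner_conj P a b.
move: P0; rewrite e1 => /base_free[-> ->].
by rewrite !rmorph0 mul0r subrr.
Qed.

(** The trace [a + a] is integral, so [a] is a polynomial after halving. Then [b y] is integral and
    [b ^+ 2 * f] is a polynomial; for [b = n / d] in lowest terms this gives [d ^+ 2 %| f], and
    separability makes [d] constant. *)
Lemma integral_gen (z : L) : integralOver phi z ->
  exists a b, z = phi a + phi b * y.
Proof.
have [a [b ->]] := base_gen z => iz.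
have iz' := integral_conj iz.
have [p ep] : exists p, a + a = tau p.
  apply: integral_base; have := integral_add iz iz'.
  by rewrite addrACA subrr addr0 -rmorphD.
have t2 : tau (2%:R^-1)%:P * 2%:R = 1 :> E.
  by rewrite -(rmorph_nat (tau) 2) -rmorphM -(polyC_natr K 2) -polyCM mulVf // !rmorph1.
have ea : a = tau (2%:R^-1 *: p).
  by rewrite -mul_polyC rmorphM -ep -mulr2n -(mulr_natl a 2) mulrA t2 mul1r.
have iby : integralOver phi (j b * y).
  have := integral_sub iz (integral_id phi (2%:R^-1 *: p)).
  by rewrite phiE -ea addrAC subrr add0r.
have [g eg] : exists g, b ^+ 2 * tau f = tau g.
  apply: integral_base; have := integral_mul iby iby.
  by rewrite mulrACA -!expr2 y2 phiE -rmorphXn -rmorphM.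
have [n [d [d0 co e]]] := tau_frac b.
have {}eg : n ^+ 2 * f = g * d ^+ 2.
  by apply: tau_inj; rewrite !rmorphM -eg -e; ring.
have df : d ^+ 2 %| f.
  have co2 : coprimep (d ^+ 2) (n ^+ 2).
    by rewrite coprimep_expl // coprimep_expr // coprimep_sym.
  by rewrite -(Gauss_dvdpr _ co2) eg dvdp_mulIr.
have /eqP/size_poly1P[c c0 dc] := square_dvd_const df.
exists (2%:R^-1 *: p), (c^-1 *: n).
rewrite phiE -ea; congr (_ + _ * _).
rewrite phiE; congr (j _).
have td0 : tau d != 0 by rewrite tau_eq0.
apply: (mulIf td0); rewrite e -rmorphM /=; congr (tau _).
by rewrite dc mulrC mul_polyC scalerA mulfV // scale1r.
Qed.

Lemma y_integral : y \in integral_pred phi.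
Proof.
apply/asboolP; exists ('X^2 - f%:P); first by rewrite monicXnsubC.
by rewrite rmorphB /= map_polyXn map_polyC /root !hornerE y2 subrr.
Qed.

Theorem integral_closure_omega :
  unit_sum_number (integral_closure phi) = USOmega <->
  size f = 3 /\ exists c, lead_coef f = c ^+ 2.
Proof.
pose yO : integral_closure phi := IntegralClosure y_integral.
apply: (@quadratic_ring_omega K f (integral_closure phi) (ic_emb phi) yO) => //.
- by apply: val_inj; rewrite /= -y2.
- move=> a b /(congr1 val) /= e; rewrite !phiE in e.
  have [/eqP + /eqP] := base_free e.
  by rewrite !tau_eq0 => /eqP-> /eqP->.
- move=> z; have /asboolP/integral_gen[a [b e]] := valP z.
  by exists a, b; apply: val_inj.
Qed.

End QuadraticExtension.

Theorem corollary1 (K : finFieldType) (p : nat)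
    (pcharK : p \in [pchar K]) (odd_p : odd p)
    (f : {poly K}) (f_sep : separable_poly f) (f_nonconst : (1 < size f)%N)
    (F : fieldExtType {fraction {poly K}}) (y : F)
    (y2 : y ^+ 2 = poly_emb F f) (F_gen : <<1; y>>%VS = {:F}%VS) :
  unit_sum_number (integral_closure (poly_emb F)) = USOmega <->
  (size f).-1 = 2%N /\ (exists c : K, lead_coef f = c ^+ 2).
Proof.
have two_neq0 : (2%:R : K) != 0.
  (* If [2] were zero in [K], the prime [p] would divide 2 and hence be even. *)
  rewrite -(dvdn_pcharf pcharK) dvdn_prime2 ?(pcharf_prime pcharK) //.
  by apply: contraL odd_p => /eqP->.
have sf : (size f).-1 = 2%N <-> size f = 3 by move: f_nonconst; lia.
rewrite sf.
apply: (@integral_closure_omega K f f_sep f_nonconst two_neq0 _ F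
  (@tofrac _) (in_alg F) (poly_emb F) y _ _ _ y2).
- by [].
- exact: fraction_coprime.
- by move=> a b /eqP; rewrite tofrac_eq => /eqP.
(* Elements of the field generated by [y] over [K(x)] are polynomials in [y]. *)
- by move=> z; apply/Fadjoin1_polyP; rewrite F_gen memvf.
Qed.
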